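(* Let $\mathcal{G}$ be a (small) groupoid, let $\mathbb{Z}[\mathcal{G}]$ be its integral groupoid ring and let $\mathbf{Z}[\mathcal{G}]$ be its free $\mathbb{Z}$-linearization. There is an isomorphism of categories $$\mathbb{Z}[\mathcal{G}]\textbf{-Mod}\;\cong\;\mathbf{Z}[\mathcal{G}]\textbf{-Mod}$$ between the category of left $\mathbb{Z}[\mathcal{G}]$-modules and the category of left $\mathbf{Z}[\mathcal{G}]$-modules.
   Context: The integral groupoid ring $\mathbb{Z}[\mathcal{G}]$ is the free abelian group on the set of all morphisms of $\mathcal{G}$, with multiplication on basis elements $g\cdot h=g\circ h$ if the source of $g$ equals the target of $h$ and $g\cdot h=0$ otherwise, extended $\mathbb{Z}$-bilinearly. For $x\in\mathrm{Ob}(\mathcal{G})$, write $e_x:=\mathrm{id}_x\in\mathbb{Z}[\mathcal{G}]$; these are orthogonal idempotents (local units). A left $\mathbb{Z}[\mathcal{G}]$-module is an abelian group $M$ with a $\mathbb{Z}$-bilinear action $\mathbb{Z}[\mathcal{G}]\times M\to M$ that is associative, $(\alpha\beta)\cdot\mathfrak{m}=\alpha\cdot(\beta\cdot\mathfrak{m})$, and locally unital, i.e. $M=\bigoplus_{x\in\mathrm{Ob}(\mathcal{G})}M_x$ with $M_x:=e_x\cdot M=\{\mathfrak{m}\in M: e_x\cdot\mathfrak{m}=\mathfrak{m}\}$. Each morphism $g:x\to y$ of $\mathcal{G}$ acts by a group homomorphism $g_*:M_x\to M_y$, which is an isomorphism with inverse $(g^{-1})_*:M_y\to M_x$. A morphism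 $f:M\to N$ of left $\mathbb{Z}[\mathcal{G}]$-modules is a group homomorphism with $f(\alpha\cdot\mathfrak{m})=\alpha\cdot f(\mathfrak{m})$ for all $\alpha\in\mathbb{Z}[\mathcal{G}]$, $\mathfrak{m}\in M$. The free $\mathbb{Z}$-linearization $\mathbf{Z}[\mathcal{G}]$ is the Ab-enriched category ($\mathbb{Z}$-algebroid) with the same objects as $\mathcal{G}$, with $\mathrm{Hom}_{\mathbf{Z}[\mathcal{G}]}(x,y)$ the free abelian group on $\mathrm{Hom}_{\mathcal{G}}(x,y)$, and with composition the $\mathbb{Z}$-bilinear extension of composition in $\mathcal{G}$. A left $\mathbf{Z}[\mathcal{G}]$-module is an Ab-enriched functor $M:\mathbf{Z}[\mathcal{G}]\to\mathbf{Ab}$ to the category of abelian groups, i.e. a functor that is a group homomorphism on each hom-group; write $M_x$ for its value at the object $x$. A morphism $\eta:M\Rightarrow N$ of left $\mathbf{Z}[\mathcal{G}]$-modules is an Ab-enriched natural transformation: group homomorphisms $\eta_x:M_x\to N_x$ for each object $x$ with $\eta_y\circ M(\alpha)=N(\alpha)\circ\eta_x$ for every $\alpha\in\mathrm{Hom}_{\mathbf{Z}[\mathcal{G}]}(x,y)$.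
   Formalization: A strict isomorphism fails for the empty groupoid (many zero modules, one functor); proved instead: an isomorphism onto the modules whose group is literally a direct sum ⊕M_x of a given family, and an equivalence with the category of all left modules over the groupoid ring. *)

(* Defs.v *)
From HB Require Import structures.
From mathcomp Require Import all_boot all_algebra finmap.
From mathcomp Require Import boolp.
From mathcomp.multinomials Require Import monalg.

Set Implicit Arguments.
Unset Strict Implicit.
Unset Printing Implicit Defensive.

Import GRing.Theory.
Local Open Scope ring_scope.

(** * Categories, functors, isomorphisms and equivalences of categories *)

Record category := Category {
  obj :> Type;
  homs : obj -> obj -> Type;
  idc : forall X, homs X X;
  compc : forall X Y Z, homs Y Z -> homs X Y -> homs X Z;
  compc1 : forall X Y (f : homs X Y), compc f (idc X) = f;
  comp1c : forall X Y (f : homs X Y), compc (idc Y) f = f;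
  compcA : forall W X Y Z (h : homs Y Z) (g : homs X Y) (f : homs W X),
    compc h (compc g f) = compc (compc h g) f
}.
Arguments idc {_} X.

Record functor (C D : category) := Functor {
  fobj :> C -> D;
  fhom : forall X Y : C, homs X Y -> homs (fobj X) (fobj Y);
  fhom1 : forall X, fhom (idc X) = idc (fobj X);
  fhomM : forall X Y Z (g : homs Y Z) (f : homs X Y),
    fhom (compc g f) = compc (fhom g) (fhom f)
}.

Definition functor_id (C : category) : functor C C.
Proof. by exists id (fun _ _ f => f). Defined.

Definition functor_comp (C D E : category) (F : functor D E) (G : functor C D) :
  functor C E.
Proof.
exists (fun X => F (G X)) (fun _ _ f => fhom F (fhom G f)).
- by move=> X; rewrite !fhom1.
- by move=> X Y Z g f; rewrite !fhomM.
Defined.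

Definition is_cat_isomorphism (C D : category) (F : functor C D) : Prop :=
  exists G : functor D C,
    functor_comp G F = functor_id C /\ functor_comp F G = functor_id D.

Definition naturally_isomorphic (C D : category) (F G : functor C D) : Prop :=
  exists (a : forall X, homs (F X) (G X)) (b : forall X, homs (G X) (F X)),
    [/\ forall X Y (f : homs X Y),
          compc (a Y) (fhom F f) = compc (fhom G f) (a X),
        forall X, compc (b X) (a X) = idc (F X)
      & forall X, compc (a X) (b X) = idc (G X)].

Definition is_cat_equivalence (C D : category) (F : functor C D) : Prop :=
  exists G : functor D C,
    naturally_isomorphic (functor_comp G F) (functor_id C) /\
    naturally_isomorphic (functor_comp F G) (functor_id D).

(** * Groupoids *)

Record groupoid := Groupoid {
  ob : Type;
  hom : ob -> ob -> Type;
  gid : forall x, hom x x;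
  gcomp : forall x y z, hom y z -> hom x y -> hom x z;
  ginv : forall x y, hom x y -> hom y x;
  gcomp1 : forall x y (g : hom x y), gcomp g (gid x) = g;
  gcomp1l : forall x y (g : hom x y), gcomp (gid y) g = g;
  gcompA : forall w x y z (k : hom y z) (h : hom x y) (g : hom w x),
    gcomp k (gcomp h g) = gcomp (gcomp k h) g;
  gcompV : forall x y (g : hom x y), gcomp g (ginv g) = gid y;
  gcompVl : forall x y (g : hom x y), gcomp (ginv g) g = gid x
}.
Arguments gid {_} x.

Record mor (G : groupoid) := Mor {
  source : ob G;
  target : ob G;
  arrow : hom source target
}.

(* Classically every type is a choiceType; [{malg int[_]}] needs one. *)
HB.instance Definition _ (G : groupoid) := gen_eqMixin (ob G).
HB.instance Definition _ (G : groupoid) := gen_choiceMixin (ob G).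
HB.instance Definition _ (G : groupoid) (x y : ob G) := gen_eqMixin (hom x y).
HB.instance Definition _ (G : groupoid) (x y : ob G) :=
  gen_choiceMixin (hom x y).
HB.instance Definition _ (G : groupoid) := gen_eqMixin (mor G).
HB.instance Definition _ (G : groupoid) := gen_choiceMixin (mor G).

(** * Bilinear extension from bases of free abelian groups

    [{malg int[K]}] is the free abelian group on [K], with basis [<< k >>]. *)

Section Bilinear.
Context {K L : choiceType} {V : zmodType} (f : K -> L -> V).

Definition biext (a : {malg int[K]}) (b : {malg int[L]}) : V :=
  \sum_(k <- msupp a) \sum_(l <- msupp b) f k l *~ (a@_k * b@_l).

Lemma biextEw (d : {fset K}) (e : {fset L}) a b :
  (msupp a `<=` d)%fset -> (msupp b `<=` e)%fset ->
  biext a b = \sum_(k <- d) \sum_(l <- e) f k l *~ (a@_k * b@_l).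
Proof.
move=> ad be; rewrite /biext (big_fset_incl _ ad) /=; last first.
  by move=> k _ /mcoeff_outdom ->; rewrite big1 // => l _; rewrite mul0r mulr0z.
apply: eq_bigr => k _; apply: big_fset_incl be _ => l _ /mcoeff_outdom ->.
by rewrite mulr0 mulr0z.
Qed.

Lemma biextDl a1 a2 b : biext (a1 + a2) b = biext a1 b + biext a2 b.
Proof.
rewrite (biextEw (msuppD_le _ _) (fsubset_refl (msupp b))).
rewrite (biextEw (fsubsetUl _ (msupp a2)) (fsubset_refl (msupp b))).
rewrite (biextEw (fsubsetUr (msupp a1) _) (fsubset_refl (msupp b))).
rewrite -big_split; apply: eq_bigr => k _; rewrite -big_split.
by apply: eq_bigr => l _; rewrite mcoeffD mulrDl mulrzDr.
Qed.

Lemma biextDr a b1 b2 : biext a (b1 + b2) = biext a b1 + biext a b2.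
Proof.
rewrite (biextEw (fsubset_refl (msupp a)) (msuppD_le _ _)).
rewrite (biextEw (fsubset_refl (msupp a)) (fsubsetUl _ (msupp b2))).
rewrite (biextEw (fsubset_refl (msupp a)) (fsubsetUr (msupp b1) _)).
rewrite -big_split; apply: eq_bigr => k _; rewrite -big_split.
by apply: eq_bigr => l _; rewrite mcoeffD mulrDr mulrzDr.
Qed.

Lemma biextU k l : biext << k >> << l >> = f k l.
Proof.
by rewrite /biext !msuppU !oner_eq0 !big_seq_fset1 !mcoeffUU mulr1 mulr1z.
Qed.

Lemma biextNl a b : biext (- a) b = - biext a b.
Proof.
apply: (addrI (biext a b)); rewrite -biextDl !subrr.
by apply: (addrI (biext 0 b)); rewrite -biextDl !addr0.
Qed.

Lemma biextNr a b : biext a (- b) = - biext a b.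
Proof.
apply: (addrI (biext a b)); rewrite -biextDr !subrr.
by apply: (addrI (biext a 0)); rewrite -biextDr !addr0.
Qed.

End Bilinear.

Lemma malg_ind (K : choiceType) (P : {malg int[K]} -> Prop) :
  (forall a, P a -> P (- a)) -> (forall a b, P a -> P b -> P (a + b)) ->
  P 0 -> (forall k, P << k >>) -> forall a, P a.
Proof.
move=> PN PD P0 PU a; rewrite (monalgE a).
elim/big_ind: _ => // k _.
have nat_case (n : nat) : P << n%:Z *g k >>.
  elim: n => [|n IHn]; first by rewrite monalgU0.
  by rewrite -addn1 PoszD monalgUD; apply: PD.
by case: (a@_k) => n; rewrite // NegzE monalgUN; apply: PN.
Qed.

(** * The groupoid ring *)

Section GroupoidRing.
Context (G : groupoid).

Definition groupoid_ring := {malg int[mor G]}.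

(* [g] after [h]; the proof [e] matches the target of [h] with the source of
   [g]. *)
Definition mor_mul (g h : mor G) : groupoid_ring :=
  match pselect (target h = source g) with
  | left e =>
      << Mor (gcomp (arrow g)
                    (eq_rect _ (fun y => hom (source h) y) (arrow h) _ e)) >>
  | right _ => 0
  end.

Definition grmul : groupoid_ring -> groupoid_ring -> groupoid_ring :=
  biext mor_mul.

Lemma mor_mulE (x y z : ob G) (g : hom y z) (h : hom x y) :
  mor_mul (Mor g) (Mor h) = << Mor (gcomp g h) >>.
Proof.
rewrite /mor_mul /=; case: pselect => // e.
by rewrite (Prop_irrelevance e (erefl y)).
Qed.

Lemma mor_mul0 (g h : mor G) : target h <> source g -> mor_mul g h = 0.
Proof. by rewrite /mor_mul; case: pselect. Qed.

Definition local_unit (x : ob G) : groupoid_ring := << Mor (gid x) >>.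

Lemma local_unit_idem (x : ob G) :
  grmul (local_unit x) (local_unit x) = local_unit x.
Proof. by rewrite /grmul biextU mor_mulE gcomp1. Qed.

Lemma local_unit_orth (x y : ob G) :
  x <> y -> grmul (local_unit x) (local_unit y) = 0.
Proof. by move=> xy; rewrite /grmul biextU mor_mul0 //= => /esym. Qed.

End GroupoidRing.

(** * Direct sums *)

(* [M] is the internal direct sum of its subgroups [P i]. *)
Definition internal_direct_sum (I : choiceType) (M : zmodType)
    (P : I -> M -> Prop) : Prop :=
  (forall m, exists (s : seq I) (c : I -> M),
     [/\ uniq s, forall i, P i (c i) & m = \sum_(i <- s) c i]) /\
  (forall (s : seq I) (c : I -> M), uniq s -> (forall i, P i (c i)) ->
     \sum_(i <- s) c i = 0 -> forall i, i \in s -> c i = 0).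

Section ExternalDirectSum.
Context {I : choiceType} (A : I -> zmodType).

Record dsum := DSum {
  coord :> forall i, A i;
  coord_finite : exists s : seq I, forall i, i \notin s -> coord i = 0
}.

Lemma dsumP (u v : dsum) : (forall i, u i = v i) -> u = v.
Proof.
case: u v => [u pu] [v pv] /= uv.
have {}uv : u = v by apply: functional_extensionality_dep.
by subst v; rewrite (Prop_irrelevance pu pv).
Qed.

HB.instance Definition _ := gen_eqMixin dsum.
HB.instance Definition _ := gen_choiceMixin dsum.

Fact dsum0_finite : exists s : seq I, forall i, i \notin s -> (0 : A i) = 0.
Proof. by exists [::]. Qed.

Fact dsumN_finite (u : dsum) :
  exists s : seq I, forall i, i \notin s -> - u i = 0.
Proof.
by case: (coord_finite u) => s us; exists s => i /us ->; rewrite oppr0.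
Qed.

Fact dsumD_finite (u v : dsum) :
  exists s : seq I, forall i, i \notin s -> u i + v i = 0.
Proof.
case: (coord_finite u) (coord_finite v) => s us [t vt]; exists (s ++ t) => i.
by rewrite mem_cat negb_or => /andP[/us -> /vt ->]; rewrite addr0.
Qed.

Definition dsum0 := DSum dsum0_finite.
Definition dsumN u := DSum (dsumN_finite u).
Definition dsumD u v := DSum (dsumD_finite u v).

Fact dsumDA : associative dsumD.
Proof. by move=> u v w; apply: dsumP => i /=; rewrite addrA. Qed.
Fact dsumDC : commutative dsumD.
Proof. by move=> u v; apply: dsumP => i /=; rewrite addrC. Qed.
Fact dsum0D : left_id dsum0 dsumD.
Proof. by move=> u; apply: dsumP => i /=; rewrite add0r. Qed.
Fact dsumND : left_inverse dsum0 dsumN dsumD.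
Proof. by move=> u; apply: dsumP => i /=; rewrite addNr. Qed.

HB.instance Definition _ :=
  GRing.isZmodule.Build dsum dsumDA dsumDC dsum0D dsumND.

Lemma coord_sum (J : Type) (s : seq J) (c : J -> dsum) i :
  (\sum_(j <- s) c j) i = \sum_(j <- s) c j i.
Proof. by elim: s => [|j s IHs]; rewrite ?big_nil // !big_cons -IHs. Qed.

(* The [i]-th summand of the direct sum, as a subgroup of it. *)
Definition summand (i : I) (v : dsum) : Prop := forall j, j != i -> v j = 0.

Lemma summand_sum : internal_direct_sum summand.
Proof.
split=> [v | s c uniq_s cP sum0 i si].
- have [s vs] := coord_finite v.
  have cfin (i : I) : exists t : seq I, forall j, j \notin t ->
      (if j == i then v j else 0) = 0.
    by exists [:: i] => j; rewrite inE => /negPf ->.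
  exists (undup s), (fun i => DSum (cfin i)); split; first exact: undup_uniq.
    by move=> i j /= /negPf ->.
  apply: dsumP => j; rewrite coord_sum /=.
  have [js|js] := boolP (j \in undup s).
    rewrite (bigD1_seq j) ?undup_uniq //= eqxx big1 ?addr0 // => i.
    by rewrite eq_sym => /negPf ->.
  rewrite vs -?(mem_undup s) // big_seq big1 // => i si.
  by case: eqP => // ji; rewrite ji si in js.
- apply: dsumP => j; have [->|ji] := eqVneq j i; last exact: cP.
  have := congr1 (fun v : dsum => v i) sum0.
  rewrite /= coord_sum (bigD1_seq i) //= big1 ?addr0 // => k.
  by rewrite eq_sym => /(cP k).
Qed.

End ExternalDirectSum.

(** * Left modules over the groupoid ring *)

Lemma additive_ext (U V : zmodType) (f g : {additive U -> V}) :
  f =1 g -> f = g.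
Proof.
move=> fg; have {}fg : f = g :> (U -> V) by apply: functional_extensionality_dep.
case: f g fg => f [[pf]] [g [[pg]]] /= fg; subst g.
by rewrite (Prop_irrelevance pf pg).
Qed.

Section RingModules.
Context (G : groupoid).

(* A bilinear associative action; local unitality is added below. *)
Record gr_action (M : zmodType) := GrAction {
  act : groupoid_ring G -> M -> M;
  actDl : forall a b m, act (a + b) m = act a m + act b m;
  actDr : forall a m n, act a (m + n) = act a m + act a n;
  actM : forall a b m, act (grmul a b) m = act a (act b m)
}.

Definition piece (M : zmodType) (S : gr_action M) (x : ob G) (m : M) : Prop :=
  act S (local_unit x) m = m.

Record gr_hom (M N : zmodType) (S : gr_action M) (T : gr_action N) := GrHom {
  gr_fun :> {additive M -> N};
  gr_funE : forall a m, gr_fun (act S a m) = act T a (gr_fun m)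
}.

Lemma gr_homP (M N : zmodType) (S : gr_action M) (T : gr_action N)
    (f g : gr_hom S T) : f =1 g -> f = g.
Proof.
case: f g => f pf [g pg] /= fg.
have {}fg : f = g by apply: additive_ext.
by subst g; rewrite (Prop_irrelevance pf pg).
Qed.

Definition gr_hom_id (M : zmodType) (S : gr_action M) : gr_hom S S.
Proof. by exists (idfun : {additive M -> M}). Defined.

Definition gr_hom_comp (M N P : zmodType) (S : gr_action M) (T : gr_action N)
  (U : gr_action P) (g : gr_hom T U) (f : gr_hom S T) : gr_hom S U.
Proof. by exists (g \o f : {additive M -> P}) => a m /=; rewrite !gr_funE. Defined.

Record ring_module := RingModule {
  rm_carrier :> zmodType;
  rm_action : gr_action rm_carrier;
  rm_local : internal_direct_sum (piece rm_action)
}.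

Definition ring_modules : category.
Proof.
exists ring_module (fun M N => gr_hom (rm_action M) (rm_action N))
  (fun M => gr_hom_id (rm_action M)) (fun _ _ _ g f => gr_hom_comp g f);
  by move=> *; apply: gr_homP.
Defined.

(* The modules for which the decomposition M = (+)_x M_x, with
   M_x = e_x M, is an equality on the nose: the underlying group is the direct
   sum of a given family, whose members are the M_x. *)
Record sum_module := SumModule {
  sm_part : ob G -> zmodType;
  sm_action : gr_action (dsum sm_part);
  sm_local : forall x v, piece sm_action x v <-> summand x v
}.

Definition sum_modules : category.
Proof.
exists sum_module (fun M N => gr_hom (sm_action M) (sm_action N))
  (fun M => gr_hom_id (sm_action M)) (fun _ _ _ g f => gr_hom_comp g f);
  by move=> *; apply: gr_homP.
Defined.

Lemma sum_module_local (M : sum_module) :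
  internal_direct_sum (piece (sm_action M)).
Proof.
suff -> : piece (sm_action M) = @summand _ (sm_part M) by exact: summand_sum.
apply: functional_extensionality_dep => x.
apply: functional_extensionality_dep => v; apply: propext.
exact: sm_local.
Qed.

Definition sum_module_inclusion : functor sum_modules ring_modules.
Proof.
by exists (fun M => RingModule (@sum_module_local M) : ring_modules)
          (fun _ _ f => f).
Defined.

End RingModules.

(** * Ab-enriched categories and their left modules *)

Record ab_category := AbCategory {
  aob : Type;
  ahom : aob -> aob -> zmodType;
  aid : forall x, ahom x x;
  acomp : forall x y z, ahom y z -> ahom x y -> ahom x z;
  acompDl : forall x y z (a b : ahom y z) (c : ahom x y),
    acomp (a + b) c = acomp a c + acomp b c;
  acompDr : forall x y z (a : ahom y z) (b c : ahom x y),
    acomp a (b + c) = acomp a b + acomp a c;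
  acomp1 : forall x y (a : ahom x y), acomp a (aid x) = a;
  acomp1l : forall x y (a : ahom x y), acomp (aid y) a = a;
  acompA : forall w x y z (c : ahom y z) (b : ahom x y) (a : ahom w x),
    acomp c (acomp b a) = acomp (acomp c b) a
}.
Arguments aid {_} x.

Section AbModules.
Context (C : ab_category).

Record ab_module := AbModule {
  am_val :> aob C -> zmodType;
  am_map : forall x y, ahom x y -> {additive am_val x -> am_val y};
  am_mapD : forall x y (a b : ahom x y) m,
    am_map (a + b) m = am_map a m + am_map b m;
  am_map1 : forall x m, am_map (aid x) m = m;
  am_mapM : forall x y z (b : ahom y z) (a : ahom x y) m,
    am_map (acomp b a) m = am_map b (am_map a m)
}.

Record ab_nat (M N : ab_module) := AbNat {
  ab_fun :> forall x, {additive M x -> N x};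
  ab_funE : forall x y (a : ahom x y) m,
    ab_fun y (am_map M a m) = am_map N a (ab_fun x m)
}.

Lemma ab_natP (M N : ab_module) (f g : ab_nat M N) :
  (forall x, f x =1 g x) -> f = g.
Proof.
case: f g => f pf [g pg] /= fg.
have {}fg : f = g.
  by apply: functional_extensionality_dep => x; exact: additive_ext (fg x).
by subst g; rewrite (Prop_irrelevance pf pg).
Qed.

Definition ab_nat_id (M : ab_module) : ab_nat M M.
Proof. by exists (fun x => idfun : {additive M x -> M x}). Defined.

Definition ab_nat_comp (M N P : ab_module) (g : ab_nat N P) (f : ab_nat M N) :
  ab_nat M P.
Proof.
by exists (fun x => g x \o f x : {additive M x -> P x}) => x y a m /=;
  rewrite !ab_funE.
Defined.

Definition ab_modules : category.
Proof.
exists ab_module ab_nat ab_nat_id (fun _ _ _ g f => ab_nat_comp g f);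
  by move=> *; apply: ab_natP.
Defined.

End AbModules.

(** * The free Z-linearization of a groupoid *)

Section Linearization.
Context (G : groupoid).

Definition lin_hom (x y : ob G) : zmodType := {malg int[hom x y]}.

Definition lin_id (x : ob G) : lin_hom x x := << gid x >>.

Definition lin_comp (x y z : ob G) : lin_hom y z -> lin_hom x y -> lin_hom x z :=
  biext (fun g h => << gcomp g h >>).

Lemma lin_comp1 x y (a : lin_hom x y) : lin_comp a (lin_id x) = a.
Proof.
elim/malg_ind: a => [a IHa|a b IHa IHb||g].
- by rewrite [LHS]biextNl; congr (- _).
- by rewrite [LHS]biextDl; congr (_ + _).
- by rewrite /lin_comp /biext msupp0 big_seq_fset0.
- by rewrite [LHS]biextU gcomp1.
Qed.

Lemma lin_comp1l x y (a : lin_hom x y) : lin_comp (lin_id y) a = a.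
Proof.
elim/malg_ind: a => [a IHa|a b IHa IHb||g].
- by rewrite [LHS]biextNr; congr (- _).
- by rewrite [LHS]biextDr; congr (_ + _).
- by apply: (addrI (lin_comp (lin_id y) 0)); rewrite -[LHS]biextDr !addr0.
- by rewrite [LHS]biextU gcomp1l.
Qed.

Lemma lin_comp0 x y z (a : lin_hom y z) : lin_comp a (0 : lin_hom x y) = 0.
Proof. by apply: (addrI (lin_comp a 0)); rewrite -[LHS]biextDr !addr0. Qed.

Lemma lin_0comp x y z (b : lin_hom x y) : lin_comp (0 : lin_hom y z) b = 0.
Proof. by apply: (addrI (lin_comp 0 b)); rewrite -[LHS]biextDl !addr0. Qed.

Lemma lin_compA w x y z (c : lin_hom y z) (b : lin_hom x y) (a : lin_hom w x) :
  lin_comp c (lin_comp b a) = lin_comp (lin_comp c b) a.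
Proof.
elim/malg_ind: c => [c IHc|c d IHc IHd||k].
- by rewrite /lin_comp !biextNl; congr (- _).
- by rewrite /lin_comp !biextDl; congr (_ + _).
- by rewrite !lin_0comp.
elim/malg_ind: b => [b IHb|b d IHb IHd||h].
- by rewrite /lin_comp !(biextNl, biextNr); congr (- _).
- by rewrite /lin_comp !(biextDl, biextDr); congr (_ + _).
- by rewrite !(lin_0comp, lin_comp0).
elim/malg_ind: a => [a IHa|a d IHa IHd||g].
- by rewrite /lin_comp !biextNr; congr (- _).
- by rewrite /lin_comp !biextDr; congr (_ + _).
- by rewrite !lin_comp0.
by rewrite /lin_comp !biextU gcompA.
Qed.

Definition linearization : ab_category :=
  @AbCategory (ob G) lin_hom lin_id lin_comp
    (fun x y z => @biextDl _ _ _ _) (fun x y z => @biextDr _ _ _ _)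
    lin_comp1 lin_comp1l lin_compA.

End Linearization.

(* Main.v *)
From HB Require Import structures.
From mathcomp Require Import all_boot all_algebra finmap.
From mathcomp Require Import boolp.
From mathcomp.multinomials Require Import monalg.
Require Import Defs.

Set Implicit Arguments.
Unset Strict Implicit.
Unset Printing Implicit Defensive.

Import GRing.Theory.
Local Open Scope ring_scope.

(** Write [e_x] for the local unit of the groupoid ring at the object [x]. An
    enriched functor [M] is turned into the direct sum of its values, on which a
    basis element [g : x -> y] acts by reading off the coordinate at [x],
    applying [M g] and placing the result at [y] ([total_module]). Two
    consecutive basis elements then act as their composite when they are
    composable and as zero otherwise, which is the multiplication rule of the
    groupoid ring; and [e_x] acts as the projection to the summand at [x]
    ([total_act_unit]). Since a homomorphism of modules commutes with the [e_x],
    it is determined by, and can be any natural family of, homomorphisms of the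
    summands ([total_functor_ff]).

    On objects the construction is undone by restricting the action: in a module
    on a direct sum of groups [A x] whose pieces are the summands, [e_x] must be
    the projection to [A x] ([sum_act_unit]), and [g = e_y g e_x] maps [A x] to
    [A y]. The family [A] is not touched in either direction, so both composites
    are equalities of objects ([total_moduleK], [parts_moduleK]). A fully
    faithful functor that is bijective on objects is an isomorphism of
    categories ([fully_faithful_isomorphism]).

    An arbitrary locally unital module [M] is only isomorphic to a direct sum:
    the map [m |-> (e_x m)_x] identifies it with the total module of the
    enriched functor [x |-> e_x M] ([decompose_hom]). This is essential
    surjectivity, and a fully faithful functor with this property is an
    equivalence ([fully_faithful_equivalence]).

    Identities in the groupoid ring and the linearization are checked on basis
    elements only, by [malg_additive_eq]. *)

(** * Recognizing isomorphisms and equivalences of categories *)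

Definition fully_faithful (C D : category) (F : functor C D) : Prop :=
  forall X Y : C, bijective (@fhom C D F X Y).

Definition isomorphic (C : category) (X Y : C) : Prop :=
  exists (a : homs X Y) (b : homs Y X),
    compc b a = idc X /\ compc a b = idc Y.

(** Transport of morphisms along equalities of objects is expressed as
    composition with these morphisms, so that functors can be applied to it. *)
Definition id_to_hom (C : category) (X Y : C) (e : X = Y) : homs X Y :=
  ecast Z (homs X Z) e (idc X).

Lemma id_to_hom_refl (C : category) (X : C) (e : X = X) : id_to_hom e = idc X.
Proof. by rewrite (Prop_irrelevance e (erefl X)). Qed.

Lemma id_to_homM (C : category) (X Y Z : C) (d : Y = Z) (e : X = Y)
    (de : X = Z) :
  compc (id_to_hom d) (id_to_hom e) = id_to_hom de.
Proof. by subst; rewrite !id_to_hom_refl compc1. Qed.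

Lemma id_to_homK (C : category) (X Y : C) (d : Y = X) (e : X = Y) :
  compc (id_to_hom d) (id_to_hom e) = idc X.
Proof. by rewrite (id_to_homM d e (erefl X)). Qed.

Lemma fhom_id_to_hom (C D : category) (F : functor C D) (X Y : C)
    (e : X = Y) (Fe : F X = F Y) :
  fhom F (id_to_hom e) = id_to_hom Fe.
Proof. by subst; rewrite !id_to_hom_refl fhom1. Qed.

Lemma functor_ext (C D : category) (F G : functor C D)
    (e : forall X, F X = G X) :
  (forall X Y (f : homs X Y),
     fhom G f = compc (id_to_hom (e Y))
                      (compc (fhom F f) (id_to_hom (esym (e X))))) ->
  F = G.
Proof.
case: F G e => [Fo Fh F1 FM] [Go Gh G1 GM] /= e.
have FG : Fo = Go by apply: functional_extensionality_dep.
subst Go => FhGh.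
have {}FhGh : Fh = Gh.
  apply: functional_extensionality_dep => X.
  apply: functional_extensionality_dep => Y.
  apply: functional_extensionality_dep => f.
  by rewrite FhGh !id_to_hom_refl compc1 comp1c.
subst Gh.
by rewrite (Prop_irrelevance F1 G1) (Prop_irrelevance FM GM).
Qed.

(** Restates [bijective] with an existential quantifier, to which the choice
    principle applies. *)
Lemma bijective_inverse (S T : Type) (f : S -> T) :
  bijective f -> exists g : T -> S, cancel f g /\ cancel g f.
Proof. by case=> g fK gK; exists g. Qed.

Section HomInverse.
Context (C D : category) (F : functor C D) (FF : fully_faithful F).

Definition fhom_inv (X Y : C) (h : homs (F X) (F Y)) : homs X Y :=
  projT1 (cid (bijective_inverse (FF X Y))) h.

Lemma fhomK (X Y : C) : cancel (@fhom _ _ F X Y) (@fhom_inv X Y).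
Proof. by rewrite /fhom_inv; case: cid => ? []. Qed.

Lemma fhom_invK (X Y : C) : cancel (@fhom_inv X Y) (@fhom _ _ F X Y).
Proof. by rewrite /fhom_inv; case: cid => ? []. Qed.

Lemma fhom_inj (X Y : C) : injective (@fhom _ _ F X Y).
Proof. exact: can_inj (@fhomK X Y). Qed.

(** The common inverse of both criteria below: [a] and [b] are isomorphisms from
    equalities [F (g Y) = Y] in the first, chosen isomorphisms in the second. A
    morphism of [D] is conjugated by them and pulled back along [F]. *)
Definition conj_functor (g : D -> C) (a : forall Y, homs (F (g Y)) Y)
    (b : forall Y, homs Y (F (g Y)))
    (ba : forall Y, compc (b Y) (a Y) = idc (F (g Y)))
    (ab : forall Y, compc (a Y) (b Y) = idc Y) : functor D C.
Proof.
exists g (fun Y Z h => fhom_inv (compc (b Z) (compc h (a Y)))).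
- by move=> Y; apply: fhom_inj; rewrite fhom_invK comp1c ba fhom1.
- move=> X Y Z k h; apply: fhom_inj; rewrite fhomM !fhom_invK -!compcA.
  by rewrite (compcA (a Y)) ab comp1c.
Defined.

Lemma fully_faithful_isomorphism (g : D -> C) :
  cancel F g -> cancel g F -> is_cat_isomorphism F.
Proof.
move=> FK gK.
pose G := conj_functor (g := g)
  (fun Y => id_to_homK (esym (gK Y)) (gK Y))
  (fun Y => id_to_homK (gK Y) (esym (gK Y))).
exists G; split.
- apply: (@functor_ext _ _ (functor_comp G F) (functor_id C) FK) => X Y f.
  apply: fhom_inj => /=; rewrite !fhomM fhom_invK.
  rewrite (fhom_id_to_hom _ (gK (F Y))) (fhom_id_to_hom _ (esym (gK (F X)))).
  by rewrite -!compcA id_to_homK compc1 compcA id_to_homK comp1c.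
- apply: (@functor_ext _ _ (functor_comp F G) (functor_id D) gK) => X Y f.
  rewrite /= fhom_invK.
  by rewrite -!compcA id_to_homK compc1 compcA id_to_homK comp1c.
Qed.

Lemma fully_faithful_equivalence :
  (forall Y, exists X, isomorphic (F X) Y) -> is_cat_equivalence F.
Proof.
move=> ess.
pose g Y := projT1 (cid (ess Y)).
have iso Y : isomorphic (F (g Y)) Y by rewrite /g; case: cid.
pose a Y := projT1 (cid (iso Y)).
have exb Y : exists b, compc b (a Y) = idc _ /\ compc (a Y) b = idc Y.
  by rewrite /a; case: cid.
pose b Y := projT1 (cid (exb Y)).
have ba Y : compc (b Y) (a Y) = idc _ by rewrite /b; case: cid => ? [].
have ab Y : compc (a Y) (b Y) = idc _ by rewrite /b; case: cid => ? [].
exists (conj_functor ba ab); split.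
- exists (fun X => fhom_inv (a (F X))), (fun X => fhom_inv (b (F X))).
  split=> [X Y f|X|X]; apply: fhom_inj; rewrite /= !fhomM ?fhom1 !fhom_invK //.
  by rewrite compcA ab comp1c.
- exists a, b; split=> // X Y h.
  by rewrite /= fhom_invK compcA ab comp1c.
Qed.

End HomInverse.

Lemma fully_faithful_comp (C D E : category) (F : functor D E)
    (G : functor C D) :
  fully_faithful F -> fully_faithful G -> fully_faithful (functor_comp F G).
Proof. by move=> FF GF X Y; apply: (bij_comp (FF _ _) (GF X Y)). Qed.

(** * Linear maps out of free abelian groups *)

(** The maps are plain functions with a proof of additivity, so that both sides
    of an identity can be compared without bundling them as morphisms. *)
Lemma malg_additive_eq (K : choiceType) (V : zmodType)
    (f g : {malg int[K]} -> V) :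
  {morph f : a b / a + b} -> {morph g : a b / a + b} ->
  (forall k, f << k >> = g << k >>) -> f =1 g.
Proof.
move=> fD gD fg.
have D0 (h : {malg int[K]} -> V) : {morph h : a b / a + b} -> h 0 = 0.
  by move=> hD; apply: (addrI (h 0)); rewrite -hD !addr0.
have DN (h : {malg int[K]} -> V) : {morph h : a b / a + b} ->
    forall a, h (- a) = - h a.
  by move=> hD a; apply: (addrI (h a)); rewrite -hD !subrr D0.
elim/malg_ind => [a IHa|a b IHa IHb||//].
- by rewrite !DN ?IHa.
- by rewrite fD gD IHa IHb.
- by rewrite !D0.
Qed.

(** A linear map is a bilinear one whose second argument ranges over the free
    abelian group on one generator, evaluated at that generator. *)
Definition linext (K : choiceType) (V : zmodType) (f : K -> V)
    (a : {malg int[K]}) : V :=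
  biext (fun k (_ : unit) => f k) a << tt >>.

Lemma linextD (K : choiceType) (V : zmodType) (f : K -> V) :
  {morph linext f : a b / a + b}.
Proof. by move=> a b; apply: biextDl. Qed.

Lemma linextU (K : choiceType) (V : zmodType) (f : K -> V) k :
  linext f << k >> = f k.
Proof. exact: biextU. Qed.

(** * Coordinates in direct sums *)

Section Injections.
Context {I : choiceType} (A : I -> zmodType).

Definition inj_coord (i : I) (m : A i) (j : I) : A j :=
  match pselect (i = j) with
  | left e => ecast k (A k) e m
  | right _ => 0
  end.

Lemma inj_coord_same i (m : A i) : inj_coord m i = m.
Proof.
rewrite /inj_coord; case: pselect => // e.
by rewrite (Prop_irrelevance e (erefl i)).
Qed.

Lemma inj_coord_neq i (m : A i) j : j != i -> inj_coord m j = 0.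
Proof.
move=> /eqP ji; rewrite /inj_coord; case: pselect => // ij.
by case: ji.
Qed.

Fact inj_finite i (m : A i) :
  exists s : seq I, forall j, j \notin s -> inj_coord m j = 0.
Proof.
by exists [:: i] => j; rewrite inE => ji; rewrite inj_coord_neq.
Qed.

Definition inj (i : I) (m : A i) : dsum A := DSum (inj_finite m).

Lemma inj_same i (m : A i) : inj m i = m.
Proof. exact: inj_coord_same. Qed.

Lemma inj_neq i (m : A i) j : j != i -> inj m j = 0.
Proof. exact: inj_coord_neq. Qed.

Lemma inj_morphism i : zmod_morphism (@inj i).
Proof.
move=> m n; apply: dsumP => j /=; have [->|ji] := eqVneq j i.
  by rewrite !inj_coord_same.
by rewrite !inj_coord_neq // subrr.
Qed.

HB.instance Definition _ i :=
  GRing.isZmodMorphism.Build (A i) (dsum A) (@inj i) (@inj_morphism i).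

Lemma summandP i (v : dsum A) : summand i v <-> inj (v i) = v.
Proof.
split=> [vi|<- j ji]; last exact: inj_neq.
apply: dsumP => j; have [->|ji] := eqVneq j i; first exact: inj_same.
by rewrite inj_neq ?vi.
Qed.

(** An element of a direct sum is a finite sum of elements of the summands. *)
Lemma dsum_ind (P : dsum A -> Prop) :
  P 0 -> (forall u v, P u -> P v -> P (u + v)) ->
  (forall i (m : A i), P (inj m)) -> forall v, P v.
Proof.
move=> P0 PD Pinj v; have [s vs] := coord_finite v.
suff -> : v = \sum_(i <- undup s) inj (v i) by elim/big_ind: _.
apply: dsumP => j; rewrite coord_sum.
have [js|js] := boolP (j \in undup s).
  rewrite (bigD1_seq j) ?undup_uniq //= inj_coord_same big1 ?addr0 // => i ij.
  by rewrite inj_coord_neq // eq_sym.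
rewrite vs -?(mem_undup s) // big_seq big1 // => i si.
by rewrite inj_neq //; apply: contraNneq js => ->.
Qed.

End Injections.

(** * Actions of the groupoid ring *)

Lemma gr_action_ext (G : groupoid) (M : zmodType) (S T : gr_action G M) :
  (forall a, act S a =1 act T a) -> S = T.
Proof.
case: S T => [s sDl sDr sM] [t tDl tDr tM] /= st.
have {}st : s = t.
  by do 2 apply: functional_extensionality_dep => ?; apply: st.
subst t; rewrite (Prop_irrelevance sDl tDl) (Prop_irrelevance sDr tDr).
by rewrite (Prop_irrelevance sM tM).
Qed.

Section Actions.
Context (G : groupoid) (M : zmodType) (S : gr_action G M).

Lemma act_morphism a : zmod_morphism (act S a).
Proof.
move=> m n; apply: (addIr (act S a n)).
by rewrite -actDr !subrK.
Qed.

HB.instance Definition _ a :=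
  GRing.isZmodMorphism.Build M M (act S a) (act_morphism a).

Lemma act0l m : act S 0 m = 0.
Proof. by apply: (addrI (act S 0 m)); rewrite -actDl !addr0. Qed.

Lemma act_unit_idem x m :
  act S (local_unit x) (act S (local_unit x) m) = act S (local_unit x) m.
Proof. by rewrite -actM local_unit_idem. Qed.

Lemma act_unit_orth x y m : x != y ->
  act S (local_unit x) (act S (local_unit y) m) = 0.
Proof. by move=> /eqP xy; rewrite -actM local_unit_orth ?act0l. Qed.

End Actions.

Section Arrows.
Context (G : groupoid).

(** The hom-groups of the linearization sit in the groupoid ring as the corners
    [e_y Z[G] e_x]. *)
Definition lin_incl (x y : ob G) : lin_hom x y -> groupoid_ring G :=
  linext (fun g : hom x y => << Mor g >>).

Lemma lin_inclD x y : {morph @lin_incl x y : a b / a + b}.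
Proof. exact: linextD. Qed.

Lemma lin_inclU x y (g : hom x y) : lin_incl << g >> = << Mor g >>.
Proof. exact: linextU. Qed.

Lemma lin_inclM x y z (b : lin_hom y z) (a : lin_hom x y) :
  lin_incl (lin_comp b a) = grmul (lin_incl b) (lin_incl a).
Proof.
move: b; apply: malg_additive_eq => [b c|b c|h].
- by rewrite /lin_comp biextDl lin_inclD.
- by rewrite lin_inclD /grmul biextDl.
move: a; apply: malg_additive_eq => [a c|a c|g].
- by rewrite /lin_comp biextDr lin_inclD.
- by rewrite lin_inclD /grmul biextDr.
by rewrite /lin_comp /grmul biextU !lin_inclU biextU mor_mulE.
Qed.

Lemma lin_incl_unitl x y (a : lin_hom x y) :
  grmul (local_unit y) (lin_incl a) = lin_incl a.
Proof.
by rewrite -[local_unit y]lin_inclU -lin_inclM lin_comp1l.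
Qed.

Lemma arrow_unitr (g : mor G) :
  grmul << g >> (local_unit (source g)) = << g >>.
Proof. by case: g => x y g; rewrite /grmul biextU mor_mulE gcomp1. Qed.

End Arrows.

(** * From enriched functors to modules on direct sums *)

Section TotalModule.
Context (G : groupoid) (M : ab_module (linearization G)).

Definition arrow_map (g : mor G) : {additive M (source g) -> M (target g)} :=
  am_map M (<< arrow g >> : @ahom (linearization G) _ _).

Definition arrow_act (g : mor G) (v : dsum M) : dsum M :=
  inj (arrow_map g (v (source g))).

Lemma arrow_actD g : {morph arrow_act g : u v / u + v}.
Proof. by move=> u v; rewrite /arrow_act /= !raddfD. Qed.

Definition total_act (a : groupoid_ring G) (v : dsum M) : dsum M :=
  linext (arrow_act^~ v) a.

Lemma total_actDl a b v : total_act (a + b) v = total_act a v + total_act b v.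
Proof. exact: linextD. Qed.

Lemma total_actU g v : total_act << g >> v = arrow_act g v.
Proof. exact: linextU. Qed.

Lemma total_actDr a u v : total_act a (u + v) = total_act a u + total_act a v.
Proof.
move: a; apply: malg_additive_eq => [a b|a b|g].
- exact: total_actDl.
- by rewrite !total_actDl addrACA.
- by rewrite !total_actU arrow_actD.
Qed.

(** When [g] and [h] are not composable, the action of [h] lands in a summand
    other than the one that [g] reads, which gives zero as in the ring. *)
Lemma arrow_act_mul g h v :
  total_act (mor_mul g h) v = arrow_act g (arrow_act h v).
Proof.
have [e|gh] := pselect (target h = source g); last first.
  rewrite mor_mul0 // /arrow_act inj_neq ?raddf0; last first.
    by apply/eqP => /esym.
  by apply: (addrI (total_act 0 v)); rewrite -total_actDl !addr0.
case: g h e => y z g [x y' h] /= e; subst y'.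
rewrite mor_mulE total_actU /arrow_act /arrow_map inj_same /=.
rewrite -(@am_mapM _ M) /=; congr (inj (am_map M _ _)).
by rewrite /lin_comp biextU.
Qed.

Lemma total_actM a b v :
  total_act (grmul a b) v = total_act a (total_act b v).
Proof.
move: a; apply: malg_additive_eq => [a c|a c|g].
- by rewrite /grmul biextDl total_actDl.
- by rewrite total_actDl.
move: b; apply: malg_additive_eq => [b c|b c|h].
- by rewrite /grmul biextDr total_actDl.
- by rewrite total_actDl total_actDr.
by rewrite /grmul biextU !total_actU arrow_act_mul.
Qed.

Definition total_action : gr_action G (dsum M) :=
  GrAction total_actDl total_actDr total_actM.

(** The action remembers [M]: on the corner [e_y Z[G] e_x] it is the action of
    [M] between the summands at [x] and [y]. *)
Lemma total_act_incl x y (a : lin_hom x y) v :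
  total_act (lin_incl a) v =
  inj (am_map M (a : @ahom (linearization G) x y) (v x)).
Proof.
move: a; apply: malg_additive_eq => [a b|a b|g].
- by rewrite lin_inclD total_actDl.
- by rewrite (@am_mapD _ M) raddfD.
- by rewrite lin_inclU total_actU.
Qed.

Lemma total_act_unit x v : total_act (local_unit x) v = inj (v x).
Proof. by rewrite -[local_unit x]lin_inclU total_act_incl (@am_map1 _ M). Qed.

Lemma total_local x v : piece total_action x v <-> summand x v.
Proof. by rewrite summandP /piece /= total_act_unit. Qed.

Definition total_module : sum_module G := SumModule total_local.

End TotalModule.

Section TotalHom.
Context (G : groupoid) (M N : ab_module (linearization G)) (f : ab_nat M N).

Fact total_fun_finite (v : dsum M) :
  exists s : seq (ob G), forall x, x \notin s -> f x (v x) = 0.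
Proof.
by have [s vs] := coord_finite v; exists s => x /vs ->; rewrite raddf0.
Qed.

Definition total_fun (v : dsum M) : dsum N := DSum (total_fun_finite v).

Lemma total_fun_morphism : zmod_morphism total_fun.
Proof. by move=> u v; apply: dsumP => x /=; rewrite raddfB. Qed.

HB.instance Definition _ :=
  GRing.isZmodMorphism.Build (dsum M) (dsum N) total_fun total_fun_morphism.

Lemma total_fun_inj x (m : M x) : total_fun (inj m) = inj (f x m).
Proof.
apply: dsumP => y /=; have [->|yx] := eqVneq y x.
  by rewrite !inj_coord_same.
by rewrite !inj_coord_neq // raddf0.
Qed.

Lemma total_funE a v :
  total_fun (act (total_action M) a v) = act (total_action N) a (total_fun v).
Proof.
move: a; apply: malg_additive_eq => [a b|a b|g].
- by rewrite actDl raddfD.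
- by rewrite actDl.
by rewrite /= !total_actU total_fun_inj ab_funE.
Qed.

Definition total_hom : gr_hom (total_action M) (total_action N) :=
  @GrHom _ _ _ _ _ (total_fun : {additive dsum M -> dsum N}) total_funE.

End TotalHom.

Definition total_functor (G : groupoid) :
  functor (ab_modules (linearization G)) (sum_modules G).
Proof.
exists (@total_module G : ab_modules (linearization G) -> sum_modules G)
       (fun (M N : ab_modules (linearization G)) (f : homs M N) => total_hom f).
- by move=> M; apply: gr_homP => v; apply: dsumP.
- by move=> M N P g f; apply: gr_homP => v; apply: dsumP.
Defined.

(** * Full faithfulness *)

Section ComponentNat.
Context (G : groupoid) (M N : ab_module (linearization G)).
Context (h : gr_hom (total_action M) (total_action N)).

Definition component_fun (x : ob G) (m : M x) : N x := h (inj m) x.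

Lemma component_morphism x : zmod_morphism (@component_fun x).
Proof. by move=> m n; rewrite /component_fun !raddfB. Qed.

HB.instance Definition _ x := GRing.isZmodMorphism.Build
  (M x) (N x) (@component_fun x) (@component_morphism x).

Lemma component_funE x y (a : @ahom (linearization G) x y) (m : M x) :
  component_fun (am_map M a m) = am_map N a (component_fun m).
Proof.
rewrite /component_fun -{1}(inj_same m) -total_act_incl.
by rewrite (gr_funE h (lin_incl a)) /= total_act_incl inj_same.
Qed.

Definition component_nat : ab_nat M N :=
  @AbNat _ _ _ (fun x => @component_fun x : {additive M x -> N x})
    component_funE.

Lemma component_natK : total_hom component_nat = h.
Proof.
apply: gr_homP => v; apply: dsumP => x /=.
rewrite /component_fun -total_act_unit (gr_funE h (local_unit x)) /=.
by rewrite total_act_unit inj_same.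
Qed.

End ComponentNat.

(** The inverse on morphisms takes [h] to its diagonal components; the other
    components vanish because [h] commutes with the local units. *)
Lemma total_functor_ff (G : groupoid) : fully_faithful (total_functor G).
Proof.
move=> M N; exists (@component_nat G M N) => f.
- by apply: ab_natP => x m /=; rewrite /component_fun /= inj_coord_same.
- exact: component_natK.
Qed.

(** * From modules on direct sums to enriched functors *)

Lemma ab_module_ext (C : ab_category) (A : aob C -> zmodType)
    (f g : forall x y, ahom x y -> {additive A x -> A y}) fD f1 fM gD g1 gM :
  (forall x y (a : ahom x y), f x y a =1 g x y a) ->
  @AbModule C A f fD f1 fM = @AbModule C A g gD g1 gM.
Proof.
move=> fg; have {}fg : f = g.
  do 3 apply: functional_extensionality_dep => ?.
  exact: additive_ext (fg _ _ _).
subst g; rewrite (Prop_irrelevance fD gD) (Prop_irrelevance f1 g1).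
by rewrite (Prop_irrelevance fM gM).
Qed.

Section PartsModule.
Context (G : groupoid) (S : sum_module G).
Let A := sm_part S.
Let T : gr_action G (dsum A) := sm_action S.

Lemma sum_piece x (m : A x) : act T (local_unit x) (inj m) = inj m.
Proof. by apply/sm_local => y yx; rewrite inj_neq. Qed.

(** The condition on pieces only says that the fixed points of [e_x] form the
    summand at [x]. That [e_x] kills the other summands, and hence is the
    projection, comes from the orthogonality of the local units. *)
Lemma sum_act_unit x (v : dsum A) : act T (local_unit x) v = inj (v x).
Proof.
move: v; apply: dsum_ind => [|u v IHu IHv|y m]; first by rewrite !raddf0.
  by rewrite !raddfD /= IHu IHv.
have [<-|xy] := eqVneq y x; first by rewrite sum_piece inj_same.
rewrite -sum_piece act_unit_orth 1?eq_sym // sum_piece.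
by rewrite inj_neq 1?eq_sym // raddf0.
Qed.

Lemma sum_act_incl x y (a : lin_hom x y) v :
  inj (act T (lin_incl a) v y) = act T (lin_incl a) v.
Proof. by rewrite -sum_act_unit -actM lin_incl_unitl. Qed.

Definition parts_map x y (a : lin_hom x y) (m : A x) : A y :=
  act T (lin_incl a) (inj m) y.

Lemma parts_map_morphism x y (a : lin_hom x y) : zmod_morphism (parts_map a).
Proof. by move=> m n; rewrite /parts_map !raddfB. Qed.

HB.instance Definition _ x y (a : lin_hom x y) :=
  GRing.isZmodMorphism.Build (A x) (A y) (parts_map a) (parts_map_morphism a).

Lemma parts_mapD x y (a b : lin_hom x y) m :
  parts_map (a + b) m = parts_map a m + parts_map b m.
Proof. by rewrite /parts_map lin_inclD actDl. Qed.

Lemma parts_map1 x m : parts_map (lin_id x) m = m.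
Proof. by rewrite /parts_map lin_inclU sum_piece inj_same. Qed.

Lemma parts_mapM x y z (b : lin_hom y z) (a : lin_hom x y) m :
  parts_map (lin_comp b a) m = parts_map b (parts_map a m).
Proof. by rewrite /parts_map sum_act_incl lin_inclM actM. Qed.

Definition parts_module : ab_module (linearization G) :=
  @AbModule (linearization G) A
    (fun x y a => parts_map a : {additive A x -> A y})
    parts_mapD parts_map1 parts_mapM.

(** On a basis element this is [e_y g e_x = g], both local units acting as
    projections. *)
Lemma total_parts_action : total_action parts_module = T.
Proof.
apply: gr_action_ext => a v /=.
move: a; apply: malg_additive_eq => [a b|a b|g].
- exact: (@total_actDl _ parts_module).
- exact: actDl.
rewrite total_actU /arrow_act /= /parts_map sum_act_incl lin_inclU.
rewrite -sum_act_unit -actM; case: g => x y g.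
by rewrite (arrow_unitr (Mor g)).
Qed.

End PartsModule.

Lemma parts_moduleK (G : groupoid) (S : sum_module G) :
  total_module (parts_module S) = S.
Proof.
rewrite /total_module; move: (@total_local _ (parts_module S)).
rewrite total_parts_action; case: S => A T loc loc'.
by rewrite (Prop_irrelevance loc loc').
Qed.

Lemma total_moduleK (G : groupoid) (M : ab_module (linearization G)) :
  parts_module (total_module M) = M.
Proof.
case: M => A f fD f1 fM; apply: ab_module_ext => x y a m /=.
by rewrite /parts_map /= total_act_incl !inj_same.
Qed.

(** * Every module is isomorphic to one on a direct sum *)

Section LocalParts.
Context (G : groupoid) (M : zmodType) (S : gr_action G M) (x : ob G).

(** A boolean form of [piece], from which the group structure on the subtype
    can be derived. *)
Definition in_part : {pred M} := fun m => act S (local_unit x) m == m.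

Fact in_part_zmod : zmod_closed in_part.
Proof.
split=> [|m n]; rewrite !unfold_in ?raddf0 //.
by move=> /eqP me /eqP ne; rewrite raddfB /= me ne.
Qed.

HB.instance Definition _ := GRing.isZmodClosed.Build M in_part in_part_zmod.

Record local_part := LocalPart {
  part_val :> M;
  part_valP : part_val \in in_part
}.

HB.instance Definition _ := [isSub for part_val].
HB.instance Definition _ := [Choice of local_part by <:].
HB.instance Definition _ := [SubChoice_isSubZmodule of local_part by <:].

Lemma act_part (m : local_part) : act S (local_unit x) m = m.
Proof. exact/eqP/part_valP. Qed.

End LocalParts.

Section Decomposition.
Context (G : groupoid) (M : ring_module G).
Let S := rm_action M.

Fact lin_act_in x y (a : lin_hom x y) (m : M) :
  act S (lin_incl a) m \in in_part S y.
Proof. by rewrite unfold_in -actM lin_incl_unitl. Qed.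

Definition local_map x y (a : lin_hom x y) (m : local_part S x) :
  local_part S y := LocalPart (lin_act_in a m).

Lemma local_map_morphism x y (a : lin_hom x y) : zmod_morphism (local_map a).
Proof. by move=> m n; apply: val_inj; rewrite /= !raddfB. Qed.

HB.instance Definition _ x y (a : lin_hom x y) :=
  GRing.isZmodMorphism.Build (local_part S x) (local_part S y)
    (local_map a) (local_map_morphism a).

Lemma local_mapD x y (a b : lin_hom x y) m :
  local_map (a + b) m = local_map a m + local_map b m.
Proof. by apply: val_inj; rewrite /= lin_inclD actDl. Qed.

Lemma local_map1 x m : local_map (lin_id x) m = m.
Proof. by apply: val_inj; rewrite /= lin_inclU act_part. Qed.

Lemma local_mapM x y z (b : lin_hom y z) (a : lin_hom x y) m :
  local_map (lin_comp b a) m = local_map b (local_map a m).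
Proof. by apply: val_inj; rewrite /= lin_inclM actM. Qed.

Definition local_module : ab_module (linearization G) :=
  @AbModule (linearization G) (fun x => local_part S x)
    (fun x y a => local_map a : {additive local_part S x -> local_part S y})
    local_mapD local_map1 local_mapM.

Lemma unit_act_in x (m : M) : act S (local_unit x) m \in in_part S x.
Proof. by rewrite unfold_in act_unit_idem. Qed.

(** The components of [m] in a decomposition into elements of the pieces have
    to be the [e_x m], by orthogonality; so these are almost all zero. *)
Lemma finite_decomposition (m : M) : exists s : seq (ob G),
  (forall x, x \notin s -> act S (local_unit x) m = 0) /\
  m = \sum_(x <- s) act S (local_unit x) m.
Proof.
have [s [c [us cP mE]]] := (rm_local M).1 m.
have em x : act S (local_unit x) m = \sum_(y <- s | y == x) c y.
  rewrite mE raddf_sum [RHS]big_mkcond; apply: eq_bigr => y _ /=.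
  by rewrite -(cP y); case: eqVneq => [->|yx];
    rewrite ?act_unit_idem ?act_unit_orth // eq_sym.
exists s; split=> [x xs|].
  rewrite em big_seq_cond big1 // => y /andP[ys /eqP yx].
  by rewrite -yx ys in xs.
rewrite {1}mE big_seq [RHS]big_seq; apply: eq_bigr => x xs.
by rewrite em -big_filter filter_pred1_uniq // big_seq1.
Qed.

Fact decompose_finite (m : M) : exists s : seq (ob G), forall x, x \notin s ->
  LocalPart (unit_act_in x m) = 0.
Proof.
have [s [ms _]] := finite_decomposition m.
by exists s => x xs; apply: val_inj; rewrite /= ms.
Qed.

Definition decompose (m : M) : dsum (fun x => local_part S x) :=
  DSum (decompose_finite m).

Lemma decompose_morphism : zmod_morphism decompose.
Proof.
by move=> m n; apply: dsumP => x; apply: val_inj; rewrite /= raddfB.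
Qed.

HB.instance Definition _ := GRing.isZmodMorphism.Build
  M (dsum (fun x => local_part S x)) decompose decompose_morphism.

Lemma decompose_part x (m : local_part S x) : decompose m = inj m.
Proof.
apply: dsumP => y; apply: val_inj; have [->|yx] := eqVneq y x.
  by rewrite inj_same /= act_part.
by rewrite inj_neq //= -act_part act_unit_orth.
Qed.

Lemma decomposeE a m :
  decompose (act S a m) = act (total_action local_module) a (decompose m).
Proof.
move: a; apply: malg_additive_eq => [a b|a b|[x y g]].
- by rewrite actDl raddfD.
- by rewrite actDl.
rewrite /= total_actU -[RHS]/(inj (local_map (<< g >> : lin_hom x y)
  (LocalPart (unit_act_in x m)))).
rewrite -decompose_part /= lin_inclU -actM.
by rewrite (arrow_unitr (Mor g)).
Qed.

Lemma decompose_inj : injective decompose.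
Proof.
apply: raddf_inj => m dm0; have [s [_ ->]] := finite_decomposition m.
rewrite big1 // => x _.
by rewrite -[LHS]/(part_val (decompose m x)) dm0.
Qed.

Lemma decompose_surj v : exists m, decompose m = v.
Proof.
move: v; apply: dsum_ind => [|u v [m <-] [n <-]|x m].
- by exists 0; rewrite raddf0.
- by exists (m + n); rewrite raddfD.
- by exists m; rewrite decompose_part.
Qed.

Definition decompose_hom : gr_hom S (total_action local_module) :=
  @GrHom _ _ _ _ _ (decompose : {additive M -> dsum local_module}) decomposeE.

End Decomposition.

(** The isomorphism is stated from [N] to [M], the direction in which essential
    surjectivity needs the inverse of [decompose_hom]. *)
Lemma bijective_gr_hom (G : groupoid) (M N : ring_module G)
    (f : gr_hom (rm_action M) (rm_action N)) :
  injective f -> (forall n, exists m, f m = n) ->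
  isomorphic (N : ring_modules G) (M : ring_modules G).
Proof.
move=> f_inj f_surj.
pose g n := projT1 (cid (f_surj n)).
have gK n : f (g n) = n by rewrite /g; case: cid.
have gB : zmod_morphism g by move=> m n; apply: f_inj; rewrite raddfB !gK.
pose gA := GRing.isZmodMorphism.Build N M g gB.
pose ga : {additive N -> M} := HB.pack g gA.
have gE a n : ga (act (rm_action N) a n) = act (rm_action M) a (ga n).
  by apply: f_inj; rewrite gr_funE !gK.
exists (GrHom gE), f; split; apply: gr_homP => m /=; first exact: gK.
by apply: f_inj; rewrite gK.
Qed.

Lemma total_functor_ess_surj (G : groupoid) (M : ring_modules G) :
  exists X, isomorphic
    (functor_comp (sum_module_inclusion G) (total_functor G) X) M.
Proof.
exists (local_module M).
exact: (@bijective_gr_hom _ M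
  (sum_module_inclusion G (total_functor G (local_module M))) (decompose_hom M)
  (@decompose_inj _ M) (@decompose_surj _ M)).
Qed.

Theorem proposition4p4 (G : groupoid) :
  exists F : functor (ab_modules (linearization G)) (sum_modules G),
    is_cat_isomorphism F /\
    is_cat_equivalence (functor_comp (sum_module_inclusion G) F).
Proof.
exists (total_functor G); split.
- exact: (fully_faithful_isomorphism (@total_functor_ff G)
    (@total_moduleK G) (@parts_moduleK G)).
- apply: fully_faithful_equivalence (@total_functor_ess_surj G).
  apply: fully_faithful_comp (@total_functor_ff G) => M N.
  by exists id.
Qed.
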